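(* Let $p$ be an odd prime and let $k$ be a positive integer. Define $l=k$ if $p\mid k$ and $l=kp$ if $p\nmid k$. Let $n\ge 1$ be an integer and let $d=\gcd(n,4l)$. Then $$-p^{-n/2}\left[\#C_k(\mathbb F_{p^n})-(p^n+1)\right]=\begin{cases} -\left(\frac{(-1)^{(n-1)/2}n}{p}\right)\sqrt{p} &\text{if } d\mid l,\ n \text{ is odd and } p\nmid n,\\ 0 &\text{if } d\mid l,\ n \text{ is odd and } p\mid n,\\ -(-1)^{n(p-1)/4} &\text{if } d\mid l,\ n\text{ is even and } p\nmid n,\\ (-1)^{n(p-1)/4}(p-1) &\text{if } d\mid l,\ n \text{ is even and } p\mid n,\\ -1 &\text{if } d\nmid l,\ \tfrac d2\mid l \text{ and } p\nmid n,\\ p-1 &\text{if } d\nmid l,\ \tfrac d2\mid l \text{ and } p\mid n,\\ -p^{\gcd(k,n)} &\text{if } d\nmid 2l,\ d\mid 4l \text{ and } p\nmid n,\\ (p-1)p^{\gcd(k,n)} &\text{if } d\nmid 2l,\ d\mid 4l \text{ and } p\mid n. \end{cases}$$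
   Context: $C_k$ denotes the smooth projective curve over $\mathbb{F}_p$ with affine equation $y^p-y=x^{p^k+1}+x$. It has exactly one point at infinity, which is rational, so $\#C_k(\mathbb{F}_{p^n})$ is $1$ plus the number of solutions $(x,y)\in\mathbb{F}_{p^n}^2$ of the affine equation. $\left(\frac{\cdot}{p}\right)$ is the Legendre symbol. *)

(* Defs.v *)
From HB Require Import structures.
From mathcomp Require Import all_boot all_order all_algebra.

Set Implicit Arguments.
Unset Strict Implicit.
Unset Printing Implicit Defensive.

Import Order.TTheory GRing.Theory Num.Theory.

Local Open Scope ring_scope.

(* Meaningful for p prime: for composite p, 'F_p is the field of integers
   modulo the smallest prime divisor of p. *)
Definition legendre (a : int) (p : nat) : int :=
  if (p %| a)%Z then 0
  else if [exists x : 'F_p, x ^+ 2 == a%:~R] then 1 else - 1.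

Definition Ck_affine_points (p k : nat) (F : finFieldType) : {set F * F} :=
  [set xy : F * F | xy.2 ^+ p - xy.2 == xy.1 ^+ (p ^ k + 1)%N + xy.1].

(* The number of F-rational points of the smooth projective model C_k of
   y^p - y = x^(p^k+1) + x, for F a finite field of characteristic p: the
   model has exactly one point at infinity, and that point is rational. *)
Definition card_Ck (p k : nat) (F : finFieldType) : nat :=
  (#|Ck_affine_points p k F| + 1)%N.

(* Main.v *)
(* Write tr for the trace to F_p and q_k(x) = tr(x^(p^k+1)).  Additive Hilbert 90
   makes #C_k - 1 equal to p times the number of zeros of q_k(x) + tr(x), and
   the substitution u = 2x+1 turns q_k(x) + tr(x) = 0 into q_k(u) = n.  So one
   needs the level sizes N(a) of q_k.

   With g = gcd(k,n), the maps x^(p^k+1) and x^2 (n/g odd), respectively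
   x^(p^g+1) (n/g even), have the same fibre sizes, so k may be replaced by 0 or
   g.  Put E(a) = N(a) - p^(n-1).  Counting pairs with q(x) = q(y) gives
   sum_a E(a)^2 = |W| (p-1) p^(n-1), where W = {z | z^(p^(2k)) = -z}.  Scaling x shows
   that E is constant on F_p^* when n is even, while for n odd and q = tr(x^2) it is
   a multiple of the quadratic character.  Hence E is known up to one sign.

   For n/g even the sign follows from p^g + 1 dividing N(1).  For q = tr(x^2) it
   follows from N(1) = 2 mod 4: the elements of trace 1 are the roots of
   X + X^p + ... + X^(p^(n-1)) - 1, so their product is the square 1 and an even
   number of them are nonsquares. *)
Require Import Defs.
From HB Require Import structures.
From mathcomp Require Import all_boot all_order all_algebra.
From mathcomp Require Import all_solvable all_field.
From mathcomp Require Import zify ring.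

Set Implicit Arguments.
Unset Strict Implicit.
Unset Printing Implicit Defensive.

Import Order.TTheory GRing.Theory Num.Theory.

Local Open Scope ring_scope.

(** * Power maps on a finite field and the sizes of their fibres *)

Section PowerMaps.

Variable F : finFieldType.

Lemma expf_pred_card (x : F) : x != 0 -> x ^+ #|F|.-1 = 1.
Proof.
move=> x0; apply: (mulfI x0); rewrite mulr1 -exprS prednK ?expf_card //.
by apply/card_gt0P; exists x.
Qed.

Lemma pred_card_gt0 : (0 < #|F|.-1)%N.
Proof. by rewrite -subn1 subn_gt0 finNzRing_gt1. Qed.

Lemma primitive_element : exists z : F, #|F|.-1.-primitive_root z.
Proof.
suff /hasP[z _ hz] : has #|F|.-1.-primitive_root (enum [pred x : F | x != 0]).
  by exists z.
apply: has_prim_root; rewrite ?pred_card_gt0 ?enum_uniq //.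
  apply/allP=> x; rewrite mem_enum inE => x0.
  by rewrite unity_rootE expf_pred_card.
by rewrite -cardE -(cardC1 (0 : F)); apply/eq_leq/eq_card.
Qed.

Lemma card_unity_roots m :
  (m %| #|F|.-1)%N -> #|[set x : F | x ^+ m == 1]| = m.
Proof.
have [z zP] := primitive_element => mq; have yP := dvdn_prim_root zP mq.
set y := z ^+ _ in yP.
have -> : [set x | x ^+ m == 1] = [set y ^+ nat_of_ord i | i in 'I_m].
  apply/setP=> x; rewrite inE; apply/eqP/imsetP=> [/(prim_rootP yP)[i ->]|].
    by exists i.
  by case=> i _ ->; rewrite exprAC (prim_expr_order yP) expr1n.
rewrite card_in_imset ?card_ord // => i j _ _ /eqP.
by rewrite (eq_prim_root_expr yP) !modn_small // => /eqP /val_inj.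
Qed.

(** Euler's criterion for e-th powers: with y = z^i for a primitive element z, the right-hand
    condition says that #|F| - 1 divides i (#|F| - 1) / e, that is, e divides i. *)
Lemma is_powerP e (y : F) : (e %| #|F|.-1)%N -> y != 0 ->
  reflect (exists x, x ^+ e = y) (y ^+ (#|F|.-1 %/ e) == 1).
Proof.
move=> eq y0; have e0 := dvdn_gt0 pred_card_gt0 eq.
apply: (iffP eqP) => [|[x xy]]; last first.
  rewrite -xy -exprM mulnC divnK // expf_pred_card //.
  by apply: contraNneq y0 => x0; rewrite -xy x0 expr0n gtn_eqF.
have [z zP] := primitive_element.
have [i ->] := prim_rootP zP (expf_pred_card y0) => /eqP.
rewrite -exprM -(prim_order_dvd zP) -{1}(divnK eq).
have h0 : (0 < #|F|.-1 %/ e)%N.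
  by rewrite divn_gt0 // dvdn_leq ?pred_card_gt0.
rewrite mulnC dvdn_pmul2r // => /dvdnP[j ->].
by exists (z ^+ j); rewrite -exprM.
Qed.

Definition pow_fiber e (y : F) := #|[set x : F | x ^+ e == y]|.

Lemma pow_fiberE e y (x : F) : (0 < e)%N -> y != 0 -> x ^+ e = y ->
  pow_fiber e y = pow_fiber e 1.
Proof.
move=> e0 y0 xy.
have x0 : x != 0 by apply: contraNneq y0 => x0; rewrite -xy x0 expr0n; case: e e0 {xy}.
rewrite /pow_fiber -(card_preimset _ (mulfI x0)); apply: eq_card => z.
by rewrite !inE exprMn xy -{2}[y]mulr1 (inj_eq (mulfI y0)).
Qed.

Lemma pow_fiber_eq0 e y : (forall x : F, x ^+ e != y) -> pow_fiber e y = 0%N.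
Proof. by move=> h; apply: eq_card0 => x; rewrite inE (negbTE (h x)). Qed.

Lemma pow_fiber_0 e : (0 < e)%N -> pow_fiber e 0 = 1%N.
Proof.
move=> e0; rewrite /pow_fiber (eq_card (_ : _ =i pred1 0)) ?card1 // => x.
by rewrite !inE expf_eq0 e0.
Qed.

Lemma sum_pow_fiber e (A : pred F) :
  (\sum_(y | A y) pow_fiber e y)%N = #|[set x : F | A (x ^+ e)]|.
Proof.
rewrite -sum1_card [RHS](partition_big (fun x => x ^+ e) A) => [|x]; last by rewrite inE.
apply: eq_bigr => y Ay; rewrite /pow_fiber -sum1_card; apply: eq_bigl => x.
by rewrite !inE; case: eqP => [->|]; rewrite ?Ay // andbF.
Qed.

(* Every fibre of the e-th power map is a fibre of the e'-th power map over
   the same point or empty, and both families of fibres exhaust F. *)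
Lemma eq_pow_fiber e e' : (0 < e)%N -> (e' %| e)%N ->
  (forall x : F, x ^+ e = 1 -> x ^+ e' = 1) -> pow_fiber e =1 pow_fiber e'.
Proof.
move=> e0 e'e h; have e'0 := dvdn_gt0 e0 e'e.
have /dvdnP[f ef] := e'e.
have le y : (pow_fiber e y <= pow_fiber e' y)%N.
  have [->|y0] := eqVneq y 0; first by rewrite !pow_fiber_0.
  case: (pickP (fun x : F => x ^+ e == y)) => [x /eqP xy|no]; last first.
    by rewrite pow_fiber_eq0 // => x; rewrite no.
  (* [x ^+ f] is an e'-th root of y, so both fibres over y are translates of the fibres over 1,
     where [h] gives the inclusion. *)
  rewrite (pow_fiberE e0 y0 xy) (@pow_fiberE e' _ (x ^+ f)) // -?exprM -?ef //.
  by apply/subset_leq_card/subsetP => z; rewrite !inE => /eqP /h ->.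
have tot d : (\sum_y pow_fiber d y)%N = #|F|.
  by rewrite (sum_pow_fiber d predT) cardsT.
move=> y; apply/eqP; move: (tot e); rewrite -(tot e') => /eqP.
rewrite (leqif_sum (fun y _ => conj (le y) (erefl _))).2 => /forallP/(_ y) //.
Qed.

End PowerMaps.

(** * Frobenius, the prime subfield and the trace *)

Section Trace.

Variables (F : finFieldType) (p n : nat).
Hypotheses (p_prime : prime p) (n_gt0 : (0 < n)%N) (cardF : #|F| = (p ^ n)%N).

Let p_gt0 : (0 < p)%N := prime_gt0 p_prime.

Lemma pcharF : p \in [pchar F].
Proof. exact: card_finPcharP cardF p_prime. Qed.

Lemma frobD k (x y : F) : (x + y) ^+ (p ^ k) = x ^+ (p ^ k) + y ^+ (p ^ k).
Proof. by rewrite exprDn_pchar // pnatX pnatE ?pcharF. Qed.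

Lemma frobN k (x : F) : (- x) ^+ (p ^ k) = - x ^+ (p ^ k).
Proof. by rewrite exprNn_pchar // pnatX pnatE ?pcharF. Qed.

Lemma frob_inj k : injective (fun x : F => x ^+ (p ^ k)).
Proof.
move=> x y /eqP; rewrite -subr_eq0 -frobN -frobD expf_eq0 => /andP[_].
by rewrite subr_eq0 => /eqP.
Qed.

Lemma frob_n (x : F) : x ^+ (p ^ n) = x.
Proof. by rewrite -cardF expf_card. Qed.

Definition prime_subfield := [set a : F | a ^+ p == a].

Lemma prime_subfieldP a :
  reflect (forall k, a ^+ (p ^ k) = a) (a \in prime_subfield).
Proof.
rewrite inE; apply: (iffP eqP) => [ha k|/(_ 1%N)]; last by rewrite expn1.
by elim: k => [|k IHk]; rewrite ?expr1 // expnSr exprM IHk.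
Qed.

Lemma natr_prime_subfield m : m%:R \in prime_subfield.
Proof. by rewrite inE -(pFrobenius_autE pcharF) pFrobenius_aut_nat. Qed.

Lemma dvdn_predn_exp m a b : (a %| b)%N -> ((m ^ a).-1 %| (m ^ b).-1)%N.
Proof. by case/dvdnP=> c ->; rewrite mulnC expnM (predn_exp (m ^ a)) dvdn_mulr. Qed.

Lemma card_prime_subfield : #|prime_subfield| = p.
Proof.
have -> : prime_subfield = 0 |: [set x : F | x ^+ p.-1 == 1].
  apply/setP=> x; rewrite !inE; have [->|x0] := eqVneq x 0.
    by rewrite expr0n gtn_eqF //= eqxx.
  by rewrite -{1}(prednK p_gt0) exprS -{3}[x]mulr1 (inj_eq (mulfI x0)).
have p1 : (0 < p.-1)%N by rewrite -subn1 subn_gt0 prime_gt1.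
rewrite cardsU1 !inE expr0n gtn_eqF // eq_sym oner_eq0 card_unity_roots.
  by rewrite add1n prednK.
by rewrite cardF -{1}(expn1 p) dvdn_predn_exp ?dvd1n.
Qed.

(** The trace to F_p as a sum of conjugates, kept as an element of F; its values lie in
    [prime_subfield], the copy of F_p in F. *)
Definition trace (x : F) := \sum_(i < n) x ^+ (p ^ i).

Lemma traceD x y : trace (x + y) = trace x + trace y.
Proof. by rewrite /trace -big_split; apply: eq_bigr => i _; apply: frobD. Qed.

Lemma traceN x : trace (- x) = - trace x.
Proof. by rewrite /trace -sumrN; apply: eq_bigr => i _; apply: frobN. Qed.

Lemma trace0 : trace 0 = 0.
Proof. by apply: (addrI (trace 0)); rewrite -traceD !addr0. Qed.

Lemma traceZ a x : a \in prime_subfield -> trace (a * x) = a * trace x.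
Proof.
move=> /prime_subfieldP ha; rewrite /trace mulr_sumr.
by apply: eq_bigr => i _; rewrite exprMn ha.
Qed.

Lemma trace_nat m : trace m%:R = (n * m)%:R.
Proof.
have /prime_subfieldP h := natr_prime_subfield m.
rewrite /trace; under eq_bigr do rewrite h.
by rewrite big_const_ord iter_addr_0 -mulrnA mulnC.
Qed.

(** Frobenius permutes the conjugates of x cyclically, since x^(p^n) = x. *)
Lemma trace_frob k x : trace (x ^+ (p ^ k)) = trace x.
Proof.
elim: k => [|k IHk]; rewrite ?expr1 // expnSr exprM -[RHS]IHk.
move: (x ^+ _) => {IHk}y; rewrite /trace -(prednK n_gt0) big_ord_recr big_ord_recl.
rewrite /= -exprM -expnS prednK // frob_n expr1 addrC; congr (_ + _).
by apply: eq_bigr => i _; rewrite -exprM -expnS.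
Qed.

Lemma trace_prime_subfield x : trace x \in prime_subfield.
Proof.
rewrite inE -{2}(trace_frob 1 x) expn1 /trace -(pFrobenius_autE pcharF).
by rewrite rmorph_sum; apply/eqP/eq_bigr => i _; rewrite /= pFrobenius_autE exprAC.
Qed.

(** * Fibres of the trace and Artin-Schreier equations *)

Definition trace_poly (a : F) : {poly F} := \sum_(i < n) 'X^(p ^ i) - a%:P.

Lemma horner_trace_poly a x : (trace_poly a).[x] = trace x - a.
Proof.
rewrite !hornerE horner_sum; congr (_ - _).
by apply: eq_bigr => i _; rewrite hornerXn.
Qed.

Lemma trace_polyE a : exists2 r : {poly F},
  trace_poly a = 'X^(p ^ n.-1) + r & (size r < (p ^ n.-1).+1)%N.
Proof.
rewrite /trace_poly; case: n n_gt0 => // m _ /=.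
rewrite big_ord_recr /= addrAC addrC; eexists; first by [].
rewrite ltnS; apply: leq_trans (size_polyD _ _) _; rewrite geq_max; apply/andP; split.
  apply: leq_trans (size_sum _ _ _) _; apply/bigmax_leqP => i _.
  by rewrite size_polyXn ltn_exp2l ?prime_gt1.
rewrite size_polyN (leq_trans (size_polyC_leq1 _)) //.
by rewrite expn_gt0 p_gt0.
Qed.

Lemma size_trace_poly a : size (trace_poly a) = (p ^ n.-1).+1.
Proof. by have [r -> hr] := trace_polyE a; rewrite size_polyDl size_polyXn. Qed.

Lemma lead_coef_trace_poly a : lead_coef (trace_poly a) = 1.
Proof.
by have [r -> hr] := trace_polyE a; rewrite lead_coefDl ?lead_coefXn ?size_polyXn.
Qed.

(** Each fibre consists of roots of a polynomial of degree p^(n-1), and the p fibres over the prime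
    subfield exhaust the p^n elements of F, so every bound is attained. *)
Lemma card_trace_fiber a :
  a \in prime_subfield -> #|[set x | trace x == a]| = (p ^ n.-1)%N.
Proof.
have le b : (#|[set x | trace x == b]| <= p ^ n.-1)%N.
  rewrite -ltnS -(size_trace_poly b) cardE; apply: max_poly_roots; rewrite ?enum_uniq //.
    by rewrite -lead_coef_eq0 lead_coef_trace_poly oner_neq0.
  by apply/allP=> x; rewrite mem_enum inE /root horner_trace_poly subr_eq0.
have tot : (\sum_(b in prime_subfield) #|[set x | trace x == b]|)%N
            = (\sum_(b in prime_subfield) p ^ n.-1)%N.
  rewrite sum_nat_const card_prime_subfield -expnS prednK // -cardF -sum1_card.
  rewrite [RHS](partition_big trace (mem prime_subfield)) => [|x _]; last first.
    exact: trace_prime_subfield.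
  by apply: eq_bigr => b _; rewrite -sum1_card; apply: eq_bigl => x; rewrite inE.
move=> aP; apply/eqP; move/eqP: tot.
by rewrite (leqif_sum (fun b _ => conj (le b) (erefl _))).2 => /forall_inP/(_ a aP).
Qed.

(** The fibre has as many elements as the degree of the monic [trace_poly a], which therefore splits
    over it. Evaluate at 0: the constant term is -a, and the sign is -1 because p^(n-1) is odd. *)
Lemma prod_trace_fiber a : odd p -> a \in prime_subfield ->
  \prod_(y | trace y == a) y = a.
Proof.
move=> p_odd aP.
have roots : all (root (trace_poly a)) (enum [set y | trace y == a]).
  by apply/allP=> x; rewrite mem_enum inE /root horner_trace_poly subr_eq0.
have := all_roots_prod_XsubC _ roots.
rewrite size_trace_poly -cardE card_trace_fiber // uniq_rootsE enum_uniq.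
move=> /(_ erefl isT).
rewrite lead_coef_trace_poly scale1r => /(congr1 (horner^~ 0)).
rewrite /= horner_trace_poly trace0 sub0r horner_prod big_enum /=.
under eq_bigr do rewrite hornerXsubC sub0r.
rewrite prodrN card_trace_fiber // -signr_odd oddX p_odd orbT expr1 mulN1r.
move/oppr_inj => {2}->; apply: eq_bigl => y; by rewrite inE.
Qed.

(** Additive Hilbert 90 by counting: a nonempty fibre of y^p - y is a coset of the prime subfield
    and lies over trace 0. There are p^(n-1) elements of trace 0 and p * p^(n-1) = #|F|, so none of
    these fibres is empty. *)
Lemma card_artin_schreier c :
  #|[set y : F | y ^+ p - y == c]| = if trace c == 0 then p else 0%N.
Proof.
pose f (y : F) := y ^+ p - y.
have fD x y : f (x + y) = f x + f y.
  by rewrite /f; have := frobD 1 x y; rewrite expn1 => ->; ring.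
have trf y : trace (f y) = 0.
  by have := trace_frob 1 y; rewrite /f traceD traceN expn1 => ->; rewrite subrr.
have le b : (#|[set y | f y == b]| <= if trace b == 0%R then p else 0%N)%N.
  case: (pickP (fun y => f y == b)) => [y /eqP <-|no]; last first.
    by rewrite (_ : [set y | _] = set0) ?cards0 //; apply/setP=> y; rewrite !inE no.
  rewrite trf eqxx -{1}card_prime_subfield -(card_preimset _ (addrI y)).
  apply/subset_leq_card/subsetP => z; rewrite !inE fD.
  by rewrite -subr_eq0 addrAC subrr add0r subr_eq0.
have tot : (\sum_b #|[set y | f y == b]|)%N
            = (\sum_b if trace b == 0%R then p else 0%N)%N.
  rewrite -big_mkcond sum_nat_const.
  have -> : #|[pred b | trace b == 0]| = #|[set x | trace x == 0]|.
    by apply: eq_card => x; rewrite inE.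
  rewrite card_trace_fiber; last by have := natr_prime_subfield 0.
  rewrite -expnSr prednK // -cardF -sum1_card.
  rewrite [RHS](partition_big f predT) //.
  by apply: eq_bigr => b _; rewrite -sum1_card; apply: eq_bigl => x; rewrite inE.
apply/eqP; move/eqP: tot.
by rewrite (leqif_sum (fun b _ => conj (le b) (erefl _))).2 => /forallP/(_ c).
Qed.

(** * Replacing the exponent k by 0 or gcd(k,n) *)

Lemma dvdn_exp_odd_add1 m j : odd j -> (m + 1 %| m ^ j + 1)%N.
Proof.
move=> j_odd; rewrite -(odd_double_half j) j_odd add1n expnS -mul2n expnM mulnC.
have h : (m ^ 2 = 1 %[mod m + 1])%N.
  case: m => [|m]; first by rewrite !modn1.
  by rewrite -[(m.+1 ^ 2)%N](_ : (m * (m.+1 + 1) + 1)%N = _) ?modnMDl //; nia.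
by rewrite /dvdn -modnDml -modnMml -modnXm h modnXm exp1n modnMml mul1n modnDml modnn.
Qed.

(** The p^k-power map inverts x, so iterating it depends only on the parity of the number of
    steps. *)
Lemma frob_inv_iter k u (x : F) : x ^+ (p ^ k) = x^-1 ->
  x ^+ (p ^ (k * u)) = if odd u then x^-1 else x.
Proof.
move=> hx; elim: u => [|u IHu]; first by rewrite muln0 expr1.
by rewrite mulnS expnD exprM hx exprVn IHu /=; case: (odd u); rewrite ?invrK.
Qed.

Lemma frob_n_iter u (x : F) : x ^+ (p ^ (n * u)) = x.
Proof.
by elim: u => [|u IHu]; rewrite ?muln0 ?expr1 // mulnS expnD exprM frob_n.
Qed.

Lemma expf_inv_eq m (x : F) : x != 0 -> (x ^+ m == x^-1) = (x ^+ (m + 1) == 1).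
Proof.
by move=> x0; rewrite exprD expr1 -(inj_eq (mulIf x0)) mulVf.
Qed.

Definition level h (a : F) := #|[set x : F | trace (x ^+ (p ^ h + 1)) == a]|.

Lemma level_sum h a :
  level h a = (\sum_(y | trace y == a) pow_fiber (p ^ h + 1) y)%N.
Proof. exact/esym/(sum_pow_fiber (p ^ h + 1) (fun y => trace y == a)). Qed.

(** By [eq_pow_fiber] it suffices to compare the solutions of x^(p^k+1) = 1, that is x^(p^k) = x^-1.
    For n' odd, n' iterations both invert x and, since n divides k n', fix it, so x^2 = 1. For n'
    even, u iterations with u odd give x^(p^g) = x^-1. *)
Lemma level_reduce (p_odd : odd p) k a : (0 < k)%N ->
  level k a = level (if odd (n %/ gcdn k n) then 0 else gcdn k n) a.
Proof.
move=> k0; have g0 : (0 < gcdn k n)%N by rewrite gcdn_gt0 k0.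
have /dvdnP[k' kE] := dvdn_gcdl k n; have /dvdnP[n' nE] := dvdn_gcdr k n.
rewrite !level_sum; apply: eq_bigr => y _; move: y.
have -> : (n %/ gcdn k n = n')%N by rewrite {1}nE mulnK.
have nz (x : F) : x ^+ (p ^ k + 1) = 1 -> x != 0.
  by move=> xe; apply: contra_eq_neq xe => ->; rewrite addn1 expr0n eq_sym oner_eq0.
(* Bezout, divided by the gcd: when n' is even, k' u = n' v + 1 makes both k' and u odd. *)
have [u v kuv _] := egcdnP n k0.
have uv : (k' * u = n' * v + 1)%N.
  by apply/eqP; rewrite -(eqn_pmul2r g0) mulnDl mul1n mulnAC -kE mulnC kuv mulnAC -nE mulnC.
case: ifP => n'_odd; apply: eq_pow_fiber; rewrite ?addn_gt0 ?orbT //.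
- by rewrite dvdn2 oddD oddX p_odd orbT.
- move=> x xe; have x0 := nz _ xe.
  move/eqP: xe; rewrite -expf_inv_eq // => /eqP xk.
  have := frob_inv_iter n' xk; rewrite n'_odd.
  have -> : (k * n' = n * k')%N.
    by apply/eqP; rewrite -(eqn_pmul2r g0) -mulnA -nE -mulnA -kE mulnC.
  by rewrite frob_n_iter => /eqP; rewrite -{1}[x]expr1 expf_inv_eq // => /eqP.
- rewrite {2}kE mulnC expnM dvdn_exp_odd_add1 //.
  by move/(congr1 odd): uv; rewrite addn1 /= !oddM n'_odd; case: (odd k').
move=> x xe; have x0 := nz _ xe; apply/eqP.
move/eqP: xe; rewrite -!expf_inv_eq // => /eqP xk.
have := frob_inv_iter u xk.
have -> : odd u.
  by move/(congr1 odd): uv; rewrite addn1 /= !oddM n'_odd andbC; case: (odd u).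
have -> : (k * u = n * v + gcdn k n)%N by rewrite mulnC kuv mulnC.
by rewrite expnD exprM frob_n_iter => ->.
Qed.

(** * The polar form and the second moment of the level sizes *)

Lemma two_neq0 (p_odd : odd p) : 2%:R != 0 :> F.
Proof.
rewrite -(dvdn_pcharf pcharF); apply: contraL p_odd => /dvdn_leq -/(_ isT).
by have := prime_gt1 p_prime; case: p => [|[|[|m]]].
Qed.

(** The radical of the polar form tr(y^(p^h) (z^(p^(2h)) + z)) of tr(x^(p^h+1)). *)
Definition twisted_radical h := [set z : F | z ^+ (p ^ (2 * h)) == - z].

Lemma trace_frobM h x y :
  trace (x ^+ (p ^ h) * y) = trace (y ^+ (p ^ h) * x ^+ (p ^ (2 * h))).
Proof.
by rewrite -(trace_frob h) exprMn -exprM -expnD addnn -mul2n mulrC.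
Qed.

Lemma trace_level_shift h y z :
  trace ((y + z) ^+ (p ^ h + 1)) = trace (y ^+ (p ^ h + 1))
    + (trace (z ^+ (p ^ h + 1)) + trace (y ^+ (p ^ h) * (z ^+ (p ^ (2 * h)) + z))).
Proof.
rewrite !exprD !expr1 frobD mulrDl !mulrDr !traceD (trace_frobM h z y).
by ring.
Qed.

(** Twice the value at z is the polar form at (z, z), which vanishes on the radical. *)
Lemma trace_twisted_radical (p_odd : odd p) h z :
  z \in twisted_radical h -> trace (z ^+ (p ^ h + 1)) = 0.
Proof.
rewrite inE -addr_eq0 => /eqP hz; apply: (mulfI (two_neq0 p_odd)).
rewrite mulr0 mulr_natl mulr2n {1}exprD expr1 trace_frobM exprD expr1.
by rewrite -traceD -mulrDr hz mulr0 trace0.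
Qed.

(** On the radical the condition always holds. Off it, y is carried bijectively to y^(p^h)
    (z^(p^(2h)) + z), whose trace is prescribed. *)
Lemma card_level_shift (p_odd : odd p) h z :
  #|[set y : F | trace ((y + z) ^+ (p ^ h + 1)) == trace (y ^+ (p ^ h + 1))]|
  = if z \in twisted_radical h then (p ^ n)%N else (p ^ n.-1)%N.
Proof.
case: ifP => hz.
  rewrite -cardF; apply: eq_card => y; rewrite inE trace_level_shift.
  rewrite (trace_twisted_radical p_odd hz); move: hz; rewrite inE -addr_eq0 => /eqP ->.
  by rewrite mulr0 trace0 !addr0 eqxx.
have l0 : z ^+ (p ^ (2 * h)) + z != 0 by rewrite addr_eq0; move: hz; rewrite inE => ->.
have inj : injective (fun y : F => y ^+ (p ^ h) * (z ^+ (p ^ (2 * h)) + z)).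
  by move=> x y /(mulIf l0) /frob_inj.
have tP : - trace (z ^+ (p ^ h + 1)) \in prime_subfield.
  by rewrite -traceN trace_prime_subfield.
rewrite -(card_trace_fiber tP) -[RHS](card_preimset _ inj); apply: eq_card => y.
rewrite !inE trace_level_shift -subr_eq0 [X in X - _]addrC addrK.
by rewrite addrC addr_eq0.
Qed.

Lemma sum_level h : (\sum_(a in prime_subfield) level h a)%N = (p ^ n)%N.
Proof.
rewrite -cardF -sum1_card.
rewrite [RHS](partition_big (fun x => trace (x ^+ (p ^ h + 1))) (mem prime_subfield)).
  by apply: eq_bigr => b _; rewrite /level -sum1_card; apply: eq_bigl => x; rewrite inE.
by move=> x _; apply: trace_prime_subfield.
Qed.

(** Pairs (y, y + z) with equal values are counted once by the common value and once by the shift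
    z. *)
Lemma sum_level_sq (p_odd : odd p) h :
  (\sum_(a in prime_subfield) level h a ^ 2)%N
  = (#|twisted_radical h| * p ^ n + (p ^ n - #|twisted_radical h|) * p ^ n.-1)%N.
Proof.
pose Q x := trace (x ^+ (p ^ h + 1)); pose D y z : bool := Q (y + z) == Q y.
have -> : (\sum_(a in prime_subfield) level h a ^ 2 = \sum_y level h (Q y))%N.
  rewrite [RHS](partition_big Q (mem prime_subfield)); last first.
    by move=> x _; apply: trace_prime_subfield.
  apply: eq_bigr => b _.
  rewrite (eq_bigr (fun _ => level h b)) => [|y /eqP -> //].
  rewrite sum_nat_const expnS expn1; congr (_ * _)%N.
  by apply: eq_card => x; rewrite !inE.
have -> : (\sum_y level h (Q y) = \sum_y \sum_z D y z)%N.
  apply: eq_bigr => y _.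
  rewrite /level -(card_preimset _ (addrI y)) -sum1dep_card big_mkcond.
  by apply: eq_bigr => z _; rewrite inE /D; case: (_ == _).
rewrite exchange_big /= (bigID (mem (twisted_radical h))) /=.
have sumD z : (\sum_y D y z)%N =
    if z \in twisted_radical h then (p ^ n)%N else (p ^ n.-1)%N.
  rewrite -card_level_shift // -sum1dep_card [RHS]big_mkcond.
  by apply: eq_bigr => y _; rewrite /D; case: (_ == _).
congr (_ + _)%N.
  by rewrite -sum_nat_const; apply: eq_bigr => z zW; rewrite sumD zW.
rewrite -cardF -cardsT -cardsDS ?subsetT // -sum_nat_const.
by apply: eq_big => z; rewrite ?inE ?andbT // => zW; rewrite sumD inE (negbTE zW).
Qed.

(** * Deviation of the level sizes from the mean *)

Definition excess h (a : F) : int := (level h a)%:Z - (p ^ n.-1)%:Z.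

Lemma sum_excess h : \sum_(a in prime_subfield) excess h a = 0.
Proof.
rewrite sumrB -(big_morph _ PoszD (erefl 0%:Z)) sum_level.
by rewrite sumr_const card_prime_subfield -mulr_natl natz -PoszM -expnS prednK ?subrr.
Qed.

Lemma sum_excess_sq (p_odd : odd p) h :
  \sum_(a in prime_subfield) excess h a ^+ 2
  = (#|twisted_radical h| * (p ^ n.-1 * p.-1))%:Z.
Proof.
have le : (#|twisted_radical h| <= p ^ n)%N by rewrite -cardF max_card.
have S2 : \sum_(a in prime_subfield) (level h a)%:Z ^+ 2
    = (#|twisted_radical h| * p ^ n + (p ^ n - #|twisted_radical h|) * p ^ n.-1)%:Z.
  rewrite -sum_level_sq // (big_morph _ PoszD (erefl 0%:Z)).
  by apply: eq_bigr => a _; rewrite -rmorphXn.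
(* With c = p^(n-1) this reads E^2 = N^2 - cN - cE, and the last term sums to zero. *)
have ex a : excess h a ^+ 2 = (level h a)%:Z ^+ 2 - (p ^ n.-1)%:Z * (level h a)%:Z
    - (p ^ n.-1)%:Z * excess h a.
  by rewrite /excess; ring.
rewrite (eq_bigr _ (fun a _ => ex a)) !sumrB -!mulr_sumr sum_excess mulr0 subr0 S2.
rewrite -(big_morph _ PoszD (erefl 0%:Z)) sum_level !PoszD !PoszM -subzn //.
have -> : (p ^ n = p * p ^ n.-1)%N by rewrite -expnS prednK.
rewrite -(subn1 p) !PoszM -subzn //; ring.
Qed.

Lemma level_scale h c a : c != 0 -> c ^+ (p ^ h + 1) \in prime_subfield ->
  level h (c ^+ (p ^ h + 1) * a) = level h a.
Proof.
move=> c0 cP; rewrite /level -(card_preimset _ (mulfI c0)); apply: eq_card => x.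
by rewrite !inE exprMn traceZ // (inj_eq (mulfI _)) ?expf_neq0.
Qed.

Lemma prime_subfield_exp a : a \in prime_subfield -> a != 0 -> a ^+ p.-1 = 1.
Proof.
rewrite inE => /eqP ha a0; apply: (mulfI a0).
by rewrite -exprS prednK // ha mulr1.
Qed.

(** The divisibility makes every nonzero a of the prime subfield a (p^h+1)-th power, since a^(p-1) =
    1; then x can be rescaled by a root. *)
Lemma level_const h a : (p.-1 * (p ^ h + 1) %| (p ^ n).-1)%N ->
  a \in prime_subfield -> a != 0 -> level h a = level h 1.
Proof.
rewrite -cardF => dvd aP a0; have e_dvd := dvdn_trans (dvdn_mull _ (dvdnn _)) dvd.
have [|c ca] := is_powerP e_dvd a0 _.
  have /dvdnP[j ->] := dvd.
  by rewrite mulnA mulnK ?addn1 // mulnC exprM prime_subfield_exp // expr1n.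
have c0 : c != 0 by apply: contraNneq a0 => c0; rewrite -ca c0 addn1 expr0n.
by rewrite -(level_scale 1 c0) ca ?mulr1.
Qed.

(** If E is constantly e on F_p^*, then sum E = 0 gives E(0) = -(p-1)e, so the second moment is
    p(p-1)e^2. *)
Lemma uniform_excess (p_odd : odd p) h : (p.-1 * (p ^ h + 1) %| (p ^ n).-1)%N ->
  [/\ forall a, a \in prime_subfield -> a != 0 -> excess h a = excess h 1,
      excess h 0 = - (p.-1%:Z * excess h 1)
    & (p%:Z * excess h 1) ^+ 2 = (#|twisted_radical h| * p ^ n)%:Z].
Proof.
move=> dvd.
have cst a : a \in prime_subfield -> a != 0 -> excess h a = excess h 1.
  by move=> aP a0; rewrite /excess (level_const dvd aP a0).
have sumP (f : F -> int) (b : int) :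
    (forall a, a \in prime_subfield -> a != 0 -> f a = b) ->
    \sum_(a in prime_subfield) f a = f 0 + p.-1%:Z * b.
  move=> fb; rewrite (bigD1 0) /=; last exact: (natr_prime_subfield 0).
  rewrite (eq_bigr (fun _ => b)) => [|a /andP[aP a0]]; last exact: fb.
  rewrite sumr_const -mulr_natl natz; congr (_ + (_)%:Z * _).
  have hP : 0 \in prime_subfield by exact: (natr_prime_subfield 0).
  have := cardsD1 0 prime_subfield; rewrite card_prime_subfield hP add1n => pE.
  rewrite [in RHS]pE /=; apply: eq_card => x.
  by rewrite in_setD1 andbC.
have E0 : excess h 0 = - (p.-1%:Z * excess h 1).
  have := sum_excess h; rewrite (sumP _ _ cst) => /eqP.
  by rewrite addr_eq0 => /eqP.
split=> //; have := sum_excess_sq p_odd h.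
rewrite (sumP _ (excess h 1 ^+ 2)) => [|a aP a0]; last by rewrite cst.
rewrite E0 => eq; have p1 : p.-1%:Z != 0.
  by have := prime_gt1 p_prime; case: p => [|[|]].
have pn : (p ^ n = p * p ^ n.-1)%N by rewrite -expnS prednK.
apply: (mulfI p1); rewrite pn !PoszM in eq *.
transitivity (p%:Z * (#|twisted_radical h|%:Z * ((p ^ n.-1)%:Z * p.-1%:Z))); last by ring.
have pE : p%:Z = p.-1%:Z + 1 by rewrite -[in LHS](prednK p_gt0) -addn1 PoszD.
by rewrite -eq pE; ring.
Qed.

(** * The case n/g even *)

Lemma odd_geom_sum a m : odd a -> odd (\sum_(i < m) a ^ i) = odd m.
Proof.
move=> a_odd; elim: m => [|m IHm]; first by rewrite big_ord0.
by rewrite big_ord_recr /= oddD IHm oddX a_odd orbT addbT.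
Qed.

(** Nonzero elements satisfy z^d = -1 with d = p^(2g) - 1, and #|F| - 1 is d times a sum of m odd
    terms. For m odd this would give 1 = -1. For m even 2d divides #|F| - 1, and 2d - d = d
    solutions remain. *)
Lemma card_twisted_radical (p_odd : odd p) g m : (0 < g)%N -> n = (2 * g * m)%N ->
  #|twisted_radical g| = if odd m then 1%N else (p ^ (2 * g))%N.
Proof.
move=> g0 nE; have N1 : -1 != 1 :> F.
  by rewrite -subr_eq0 -opprD oppr_eq0; apply: two_neq0.
have q_gt0 : (0 < p ^ (2 * g))%N by rewrite expn_gt0 p_gt0.
pose d := (p ^ (2 * g)).-1.
have WE : twisted_radical g = 0 |: [set z : F | z ^+ d == -1].
  apply/setP=> z; rewrite !inE -(prednK q_gt0) -/d; have [->|z0] := eqVneq z 0.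
    by rewrite expr0n oppr0 eqxx.
  by rewrite exprS -[- z]mulrN1 (inj_eq (mulfI z0)).
have d_odd : odd d = false.
  by move: q_gt0; rewrite /d; case E: (p ^ _)%N => [|j] // _; have := oddX p (2 * g);
     rewrite E p_odd orbT /= => /negbTE.
have d0 : (0 < d)%N.
  rewrite /d -subn1 subn_gt0 -{1}(exp1n (2 * g)) ltn_exp2r ?prime_gt1 //.
  by rewrite muln_gt0.
have qE : (#|F|.-1 = d * \sum_(i < m) (p ^ (2 * g)) ^ i)%N.
  by rewrite cardF nE expnM predn_exp.
rewrite WE cardsU1 inE expr0n gtn_eqF //= eq_sym oppr_eq0 oner_eq0 /=.
case: ifP => m_odd.
  rewrite (_ : [set z | _] = set0) ?cards0 //; apply/setP=> z; rewrite !inE.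
  apply/negP => /eqP zd; have z0 : z != 0.
    by apply: contra_eq_neq zd => ->; rewrite expr0n gtn_eqF // eq_sym oppr_eq0 oner_eq0.
  have := expf_pred_card z0; rewrite qE exprM zd.
  rewrite -signr_odd odd_geom_sum ?oddX ?p_odd ?orbT //.
  by rewrite m_odd expr1 => /eqP; rewrite (negbTE N1).
have d2 : (d * 2 %| #|F|.-1)%N.
  by rewrite qE dvdn_pmul2l // dvdn2 odd_geom_sum ?m_odd ?oddX ?p_odd ?orbT.
have := card_unity_roots d2.
have := card_unity_roots (dvdn_trans (dvdn_mulr 2 (dvdnn d)) d2).
set A := [set _ | _]; set B := [set _ | _] => cA cB.
have -> : [set z : F | z ^+ d == -1] = B :\: A.
  apply/setP=> z; rewrite !inE exprM sqrf_eq1; have [->|] := eqVneq (z ^+ d) 1.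
    by rewrite eq_sym (negbTE N1).
  by [].
rewrite cardsDS ?cA ?cB; last first.
  by apply/subsetP=> z; rewrite !inE exprM => /eqP ->; rewrite expr1n.
by rewrite muln2 -addnn addnK add1n prednK.
Qed.

Lemma dvdn_level h a : (p ^ h + 1 %| (p ^ n).-1)%N -> a != 0 ->
  (p ^ h + 1 %| level h a)%N.
Proof.
rewrite -cardF => dvd a0; rewrite level_sum; apply: dvdn_sum => y /eqP ya.
have y0 : y != 0 by apply: contraNneq a0 => y0; rewrite -ya y0 trace0.
case: (pickP (fun x : F => x ^+ (p ^ h + 1) == y)) => [x /eqP xy|no]; last first.
  by rewrite pow_fiber_eq0 // => x; rewrite no.
rewrite (pow_fiberE _ y0 xy) ?addn_gt0 ?orbT //.
by rewrite /pow_fiber card_unity_roots.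
Qed.

Lemma excess_even (p_odd : odd p) g m : (0 < g)%N -> n = (2 * g * m)%N ->
  [/\ forall a, a \in prime_subfield -> a != 0 -> excess g a = excess g 1,
      excess g 0 = - (p.-1%:Z * excess g 1)
    & p%:Z * excess g 1 = p%:Z ^+ (g * (m + ~~ odd m))].
Proof.
move=> g0 nE.
have d1 : (p.-1 * (p ^ g + 1) %| (p ^ (2 * g)).-1)%N.
  have -> : ((p ^ (2 * g)).-1 = (p ^ g).-1 * (p ^ g + 1))%N.
    by rewrite mulnC expnM -!subn1 -{2}(exp1n 2) subn_sqr.
  by rewrite dvdn_pmul2r ?addn1 // -{1}(expn1 p) dvdn_predn_exp ?dvd1n.
have dvd : (p.-1 * (p ^ g + 1) %| (p ^ n).-1)%N.
  by apply: dvdn_trans d1 _; rewrite dvdn_predn_exp // nE dvdn_mulr.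
have [cst E0 sq] := uniform_excess p_odd dvd; split=> //.
(* j is m rounded up to an odd number; in both cases the radical has p^(2gj - n) elements. *)
pose j := (m + ~~ odd m)%N; pose M := (p ^ g + 1)%N.
have j_odd : odd j by rewrite oddD; case: (odd m).
have {}sq : (p%:Z * excess g 1) ^+ 2 = (p%:Z ^+ (g * j)) ^+ 2.
  rewrite sq (card_twisted_radical p_odd g0 nE) -exprM -rmorphXn /=.
  congr (Posz _); rewrite {1}nE /j; case: (odd m); rewrite ?mul1n -?expnD.
    by rewrite /= addn0 [(g * m * 2)%N]mulnC mulnA.
  by rewrite /= [(g * _ * 2)%N]mulnC mulnA addn1 mulnS.
have Md : (M %| (p ^ n).-1)%N := dvdn_trans (dvdn_mull _ (dvdnn _)) dvd.
have /dvdnP[c lvl] := dvdn_level Md (oner_neq0 F).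
have /dvdnP[u pn] := Md.
have /dvdnP[w pj] : (M %| p ^ (g * j) + 1)%N by rewrite expnM dvdn_exp_odd_add1.
move/eqP: sq; rewrite eqf_sqr => /orP[/eqP //|/eqP sq].
(* The wrong sign p E(1) = -p^(gj) reads p N(1) - (p^n - 1) + (p^(gj) + 1) = 2, where M divides
   every term on the left; but M > 2. *)
have : (M%:Z %| 2)%Z.
  apply/dvdzP; exists (p%:Z * c%:Z - u%:Z + w%:Z).
  move/(congr1 Posz): lvl; move/(congr1 Posz): pn; move/(congr1 Posz): pj.
  rewrite -subn1 -subzn ?expn_gt0 ?p_gt0 // PoszD !PoszM.
  have : (p ^ n)%:Z = p%:Z * (p ^ n.-1)%:Z by rewrite -PoszM -expnS prednK.
  move: sq; rewrite /excess -rmorphXn /= => sq pn' e1 e2 e3.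
  rewrite mulrDl mulrBl -e1 -e2 -mulrA -e3.
  by move/eqP: sq; rewrite mulrBr -pn' subr_eq => /eqP ->; ring.
rewrite /dvdz /= => /dvdn_leq -/(_ isT).
have : (2 < p)%N by have := prime_gt1 p_prime; move: p_odd; case: p => [|[|[|]]].
have : (p ^ 1 <= p ^ g)%N by rewrite leq_exp2l ?prime_gt1.
by rewrite /M addn1 expn1 => h1 h2 /ltnW h3; have := leq_trans (leq_trans h2 h1) h3.
Qed.

(** * The quadratic form tr(x^2) *)

Lemma odd_pred_card (p_odd : odd p) : odd #|F|.-1 = false.
Proof.
have := oddX p n; rewrite -cardF p_odd orbT.
by have := pred_card_gt0 F; case: #|F| => // m _ /=; exact: negbTE.
Qed.

Lemma dvdn2_pred_card (p_odd : odd p) : (2 %| #|F|.-1)%N.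
Proof. by rewrite dvdn2 odd_pred_card. Qed.

Lemma square_char (p_odd : odd p) (y : F) : y != 0 ->
  y ^+ (#|F|.-1)./2 = if y ^+ (#|F|.-1)./2 == 1 then 1 else -1.
Proof.
move=> y0; case: eqP => // /eqP y1; apply/eqP; move: (expf_pred_card y0).
rewrite -{1}[#|F|.-1]odd_double_half odd_pred_card // add0n -muln2 exprM => /eqP.
by rewrite sqrf_eq1 (negbTE y1).
Qed.

Lemma pow_fiber_square (p_odd : odd p) (y : F) : y != 0 ->
  pow_fiber 2 y = if y ^+ (#|F|.-1)./2 == 1 then 2%N else 0%N.
Proof.
move=> y0; rewrite -divn2.
case: (is_powerP (dvdn2_pred_card p_odd) y0) => [[x xy]|no].
  by rewrite (pow_fiberE _ y0 xy) // /pow_fiber card_unity_roots ?dvdn2_pred_card.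
by apply: pow_fiber_eq0 => x; apply/eqP => xy; apply: no; exists x.
Qed.

Lemma trace1_neq0 (y : F) : trace y == 1 -> y != 0.
Proof. by apply: contraTneq => ->; rewrite trace0 eq_sym oner_eq0. Qed.

Lemma prime_subfield1 : 1 \in prime_subfield.
Proof. exact: (natr_prime_subfield 1). Qed.

(* The elements of trace 1 have product 1, which is a square, so an even
   number of them are nonsquares. *)
Lemma level0_mod4 (p_odd : odd p) : (level 0 1%R = 2 %[mod 4])%N.
Proof.
pose N := (#|F|.-1)./2; pose sq (y : F) := y ^+ N == 1.
have lvl : level 0 1 = (#|[set y | (trace y == 1%R) && sq y]| * 2)%N.
  rewrite level_sum -sum_nat_const big_mkcond [RHS]big_mkcond.
  apply: eq_bigr => y _; rewrite inE; case: ifP => //= y1.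
  by rewrite expn0 pow_fiber_square // ?trace1_neq0.
have even : odd #|[set y | (trace y == 1) && ~~ sq y]| = false.
  have : \prod_(y | trace y == 1) y ^+ N = 1.
    by rewrite prodrXl prod_trace_fiber ?prime_subfield1 // expr1n.
  rewrite (bigID sq) /= big1 => [|y /andP[_ /eqP //]]; rewrite mul1r.
  rewrite (eq_bigr (fun _ => -1)) => [|y /andP[y1 /negbTE nsq]]; last first.
    by rewrite square_char ?trace1_neq0 // [_ == 1]nsq.
  rewrite prodr_const -signr_odd cardsE; case: odd => //= /eqP.
  by rewrite expr1 -subr_eq0 -opprD oppr_eq0 (negbTE (two_neq0 p_odd)).
(* The fibre over 1 has odd size p^(n-1), so an odd number of its elements are squares, each with
   two roots. *)
have tot := card_trace_fiber prime_subfield1.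
rewrite -(cardsID [set y | sq y]) in tot; move/(congr1 odd): tot.
rewrite oddX p_odd orbT oddD.
have -> : [set x | trace x == 1] :&: [set y | sq y] = [set y | (trace y == 1) && sq y].
  by apply/setP=> y; rewrite !inE.
have -> : [set x | trace x == 1] :\: [set y | sq y] = [set y | (trace y == 1) && ~~ sq y].
  by apply/setP=> y; rewrite !inE andbC.
rewrite even addbF lvl; move: (#|_|) => m m_odd.
by rewrite -(odd_double_half m) m_odd -muln2 mulnDl -mulnA addnC modnMDl.
Qed.

(** The signed prime congruent to 1 modulo 4; its powers carry the sign in the quadratic case. *)
Definition pstar : int := (-1) ^+ p.-1./2 * p%:Z.

Lemma half_pred (p_odd : odd p) : p.-1 = p.-1./2.*2.
Proof.
by rewrite -[LHS]odd_double_half; move: p_odd; case: p => //= m; rewrite /= => /negbTE ->.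
Qed.

Lemma pstar_mod4 (p_odd : odd p) j : (4 %| pstar ^+ j - 1)%Z.
Proof.
rewrite subrX1 dvdz_mulr //.
have pE : p%:Z = p.-1./2%:Z * 2 + 1.
  by rewrite -{1}(prednK p_gt0) {1}half_pred // -addn1 PoszD -muln2 PoszM.
rewrite /pstar pE -signr_odd; move: p.-1./2 => h.
rewrite -[in h%:Z](odd_double_half h) PoszD -muln2 PoszM.
move: (h./2) => c; apply/dvdzP.
by case: odd; [exists (-1 - c%:Z) | exists c%:Z]; rewrite ?expr1 ?expr0 /=; ring.
Qed.

Lemma pstar_sq : pstar ^+ 2 = p%:Z ^+ 2.
Proof. by rewrite exprMn -exprM mulnC exprM sqrrN !expr1n mul1r. Qed.

(** Fixes a sign: x = -y would make both y and -y congruent to 1 modulo 4. *)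
Lemma eq_of_sq_mod4 (x y : int) : x ^+ 2 = y ^+ 2 ->
  (4 %| x - 1)%Z -> (4 %| y - 1)%Z -> x = y.
Proof.
move/eqP; rewrite eqf_sqr => /orP[/eqP //|/eqP ->] /dvdzP[a ha] /dvdzP[b hb].
by exfalso; lia.
Qed.

Lemma twisted_radical0 (p_odd : odd p) : #|twisted_radical 0| = 1%N.
Proof.
rewrite (_ : twisted_radical 0 = [set 0]) ?cards1 //; apply/setP=> z.
rewrite !inE muln0 expr1 -addr_eq0 -mulr2n -mulr_natl mulf_eq0.
by rewrite (negbTE (two_neq0 p_odd)).
Qed.

Lemma level0_int_mod4 (p_odd : odd p) : exists j : int, (level 0 1)%:Z = 4 * j + 2.
Proof.
exists ((level 0 1%R %/ 4)%N%:Z); rewrite {1}(divn_eq (level 0 1) 4) level0_mod4 //.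
by rewrite PoszD PoszM mulrC.
Qed.

(** The radical is trivial, so (p E(1))^2 = p^n. The sign follows modulo 4: p E(1) = p N(1) - p^n is
    congruent to 2 - 1. *)
Lemma excess_square_even (p_odd : odd p) : ~~ odd n ->
  [/\ forall a, a \in prime_subfield -> a != 0 -> excess 0 a = excess 0 1,
      excess 0 0 = - (p.-1%:Z * excess 0 1)
    & p%:Z * excess 0 1 = pstar ^+ n./2].
Proof.
move=> n_even; have nE : n = (n./2 * 2)%N.
  by rewrite muln2 -[LHS]odd_double_half (negbTE n_even).
have dvd : (p.-1 * (p ^ 0 + 1) %| (p ^ n).-1)%N.
  have -> : (p.-1 * (p ^ 0 + 1) = p.-1 * 2)%N by [].
  rewrite predn_exp dvdn_pmul2l -?subn1 ?subn_gt0 ?prime_gt1 //.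
  by rewrite dvdn2 odd_geom_sum.
have [cst E0 sq] := uniform_excess p_odd dvd; split=> //.
apply: eq_of_sq_mod4; last exact: pstar_mod4.
  rewrite sq twisted_radical0 // mul1n -exprM mulnC exprM pstar_sq -exprM.
  by rewrite mulnC -nE -rmorphXn.
have [j lE] := level0_int_mod4 p_odd.
rewrite /excess lE mulrBr -PoszM -expnS prednK //.
have p2 : (4 %| (p ^ n)%:Z - 1)%Z.
  have -> : (p ^ n)%:Z = pstar ^+ (2 * n./2); last exact: pstar_mod4.
  by rewrite exprM pstar_sq -exprM mulnC -nE -rmorphXn.
have p1 : (4 %| p%:Z * 2 - 2)%Z.
  by rewrite -{1}(prednK p_gt0) half_pred //; apply/dvdzP; exists p.-1./2%:Z;
     rewrite -addn1 PoszD -muln2 PoszM; ring.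
have -> : p%:Z * (4 * j + 2) - (p ^ n)%:Z - 1 =
  4 * (p%:Z * j) + (p%:Z * 2 - 2) - ((p ^ n)%:Z - 1) by ring.
by rewrite rpredB // rpredD // dvdz_mulr.
Qed.

Lemma half_card_mul (p_odd : odd p) :
  (#|F|.-1)./2 = (p.-1./2 * \sum_(i < n) p ^ i)%N.
Proof.
by rewrite cardF predn_exp {1}half_pred // -muln2 mulnAC muln2 doubleK.
Qed.

(** For n odd the quadratic character of F restricts to that of F_p: the two exponents differ by the
    factor 1 + p + ... + p^(n-1), a sum of n odd terms. *)
Lemma prime_subfield_half (p_odd : odd p) a : odd n -> a \in prime_subfield ->
  a != 0 -> a ^+ (#|F|.-1)./2 = a ^+ p.-1./2.
Proof.
move=> n_odd aP a0; rewrite half_card_mul // exprM.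
have : (a ^+ p.-1./2) ^+ 2 == 1.
  by rewrite -exprM muln2 -half_pred // prime_subfield_exp.
rewrite sqrf_eq1 => /orP[]/eqP ->; first by rewrite expr1n.
by rewrite -signr_odd odd_geom_sum // n_odd.
Qed.

(** Since c is a nonsquare, y and cy have two square roots in total, also for y = 0. Hence N(ca) +
    N(a) = 2 p^(n-1). *)
Lemma excess_nonsquare (p_odd : odd p) c a : c \in prime_subfield ->
  a \in prime_subfield -> c ^+ (#|F|.-1)./2 = -1 -> excess 0 (c * a) = - excess 0 a.
Proof.
move=> cP aP cN; have N0 : (0 < (#|F|.-1)./2)%N.
  have := pred_card_gt0 F; have := odd_pred_card p_odd.
  by case: (#|F|.-1) => [|[|m]].
have c0 : c != 0.
  by apply: contra_eq_neq cN => ->; rewrite expr0n gtn_eqF // eq_sym oppr_eq0 oner_eq0.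
have tot : (level 0 (c * a)%R + level 0 a = p ^ n.-1 * 2)%N.
  rewrite !level_sum (reindex_inj (mulfI c0)) /=.
  rewrite (eq_bigl (fun y => trace y == a)) => [|y]; last first.
    by rewrite traceZ // (inj_eq (mulfI c0)).
  rewrite -big_split /= -(card_trace_fiber aP) -sum_nat_const.
  apply: eq_big => [y|y _]; rewrite ?inE // expn0.
  have [->|y0] := eqVneq y 0; first by rewrite mulr0 pow_fiber_0.
  rewrite !pow_fiber_square ?mulf_neq0 // exprMn cN mulN1r.
  have N1 : (-1 == 1 :> F) = false.
    by rewrite eq_sym -subr_eq0 opprK -mulr2n (negbTE (two_neq0 p_odd)).
  have := square_char p_odd y0; case: ifP => [/eqP yN _|_ yN]; rewrite yN.
    by rewrite N1.
  by rewrite opprK eqxx.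
apply/eqP; rewrite -addr_eq0 /excess addrACA -opprD -PoszD tot muln2 -addnn PoszD.
by rewrite subrr.
Qed.

(** Zero and the (p-1)/2 roots of X^((p-1)/2) - 1 are too few to fill the prime subfield. *)
Lemma prime_subfield_nonsquare (p_odd : odd p) : odd n ->
  exists2 c, c \in prime_subfield & c ^+ (#|F|.-1)./2 = -1.
Proof.
move=> n_odd; have p1 : (0 < p.-1)%N by rewrite -subn1 subn_gt0 prime_gt1.
have h_dvd : (p.-1./2 %| #|F|.-1)%N.
  by rewrite cardF predn_exp dvdn_mulr // [X in (_ %| X)%N]half_pred // -muln2 dvdn_mulr.
have : ~~ (prime_subfield \subset 0 |: [set x : F | x ^+ p.-1./2 == 1]).
  apply/negP => /subset_leq_card; rewrite card_prime_subfield cardsU1.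
  rewrite card_unity_roots // leqNgt => /negP[].
  apply: leq_ltn_trans (leq_add (leq_b1 _) (leqnn _)) _.
  rewrite add1n -[X in (_ < X)%N](prednK p_gt0) ltnS {2}half_pred // -addnn.
  rewrite -{1}[p.-1./2]addn0 ltn_add2l half_gt0.
  by move: p1; rewrite half_pred //; case: half.
case/subsetPn => c cP; rewrite !inE negb_or => /andP[c0 ch].
exists c => //; rewrite square_char // prime_subfield_half // (negbTE ch) //.
Qed.

Lemma excess_square_odd0 (p_odd : odd p) : odd n -> excess 0 0 = 0.
Proof.
move=> n_odd; have [c cP cN] := prime_subfield_nonsquare p_odd n_odd.
have := excess_nonsquare p_odd cP (natr_prime_subfield 0) cN.
by rewrite mulr0; move: (excess 0 0) => e; lia.
Qed.

Lemma excess_square_odd_char (p_odd : odd p) a : odd n ->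
  a \in prime_subfield -> a != 0 ->
  excess 0 a = (if a ^+ p.-1./2 == 1 then 1 else -1) * excess 0 1.
Proof.
move=> n_odd aP a0; rewrite -(prime_subfield_half p_odd) //.
case: ifP => [asq|ansq].
  rewrite mul1r /excess; rewrite -divn2 in asq.
  have [|c ca] := is_powerP (dvdn2_pred_card p_odd) a0 _; first exact: asq.
  have c0 : c != 0 by apply: contraNneq a0 => c0; rewrite -ca c0 expr0n.
  by rewrite -ca -[c ^+ 2]mulr1 (@level_scale 0) // [_ ^+ _]ca.
rewrite mulN1r -[a in LHS]mulr1 excess_nonsquare ?prime_subfield1 //.
by rewrite square_char // ansq.
Qed.

(** E(0) = 0 and E = E(1) or -E(1) elsewhere, so the second moment gives E(1)^2 = p^(n-1); the sign
    comes from E(1) = N(1) - p^(n-1), congruent to 2 - 1 modulo 4. *)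
Lemma excess_square_odd (p_odd : odd p) a : odd n ->
  a \in prime_subfield -> a != 0 ->
  excess 0 a = (if a ^+ p.-1./2 == 1 then 1 else -1) * pstar ^+ n./2.
Proof.
move=> n_odd aP a0; rewrite (excess_square_odd_char p_odd n_odd aP a0); congr (_ * _).
have nE : (n.-1 = 2 * n./2)%N.
  by rewrite mul2n -{1}[n]odd_double_half n_odd add1n.
have p1 : p.-1%:Z != 0 by have := prime_gt1 p_prime; case: p => [|[|]].
apply: eq_of_sq_mod4; last exact: pstar_mod4.
  apply: (mulfI p1); rewrite -exprM [(n./2 * 2)%N]mulnC exprM pstar_sq -exprM -nE.
  have := sum_excess_sq p_odd 0; rewrite twisted_radical0 // mul1n => sq.
  rewrite -[p%:Z ^+ _]rmorphXn -PoszM mulnC -[RHS]sq.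
  have hP0 : 0 \in prime_subfield by exact: (natr_prime_subfield 0).
  rewrite (bigD1 0) //= excess_square_odd0 // expr0n add0r.
  rewrite (eq_bigr (fun _ => excess 0 1 ^+ 2)) => [|b /andP[bP b0]]; last first.
    by rewrite excess_square_odd_char //; case: ifP; rewrite ?mul1r ?mulN1r ?sqrrN.
  rewrite sumr_const -mulr_natl natz; congr (_%:Z * _).
  have := cardsD1 0 prime_subfield; rewrite card_prime_subfield hP0 add1n => pE.
  rewrite [in LHS]pE /=; apply: eq_card => x.
  by rewrite in_setD1 andbC.
have [j lE] := level0_int_mod4 p_odd; rewrite /excess lE.
have p2 : (4 %| (p ^ n.-1)%:Z - 1)%Z.
  have -> : (p ^ n.-1)%:Z = pstar ^+ (2 * n./2); last exact: pstar_mod4.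
  by rewrite exprM pstar_sq -exprM -nE -rmorphXn.
have -> : 4 * j + 2 - (p ^ n.-1)%:Z - 1 = 4 * j - ((p ^ n.-1)%:Z - 1) by ring.
by rewrite rpredB // dvdz_mulr.
Qed.

(** * From the curve to level sizes *)

Lemma card_affine_points (p_odd : odd p) k :
  #|Ck_affine_points p k F| = (p * level k n%:R)%N.
Proof.
have -> : #|Ck_affine_points p k F| =
    (\sum_(x : F) #|[set y : F | (y ^+ p - y == x ^+ (p ^ k + 1)%N + x)%R]|)%N.
  rewrite -sum1_card (partition_big fst predT) //=.
  apply: eq_bigr => x _; rewrite -sum1_card (reindex_onto (pair x) snd) /=; last first.
    by case=> x' y /andP[_ /eqP /= ->].
  by apply: eq_bigl => y; rewrite !inE /= !eqxx !andbT.
under eq_bigr do rewrite card_artin_schreier.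
rewrite -big_mkcond sum_nat_const mulnC; congr (_ * _)%N.
pose u (x : F) := 2%:R * x + 1.
have two0 := two_neq0 p_odd.
have inj : injective u by move=> x y /addIr /(mulfI two0).
rewrite /level -(card_preimset _ inj); apply: eq_card => x; rewrite !inE.
have /prime_subfieldP two := natr_prime_subfield 2.
(* Completing the square: 2 x^(p^k) and 2x have equal traces, together 4 tr(x), and the constant 1
   has trace n. *)
have -> : trace (u x ^+ (p ^ k + 1)) = 2%:R ^+ 2 * trace (x ^+ (p ^ k + 1) + x) + n%:R.
  have -> : u x ^+ (p ^ k + 1) =
      2%:R ^+ 2 * x ^+ (p ^ k + 1) + 2%:R * x ^+ (p ^ k) + 2%:R * x + 1.
    by rewrite !exprD !expr1 frobD exprMn two expr1n /u; ring.
  have t1 : trace 1 = n%:R by have := trace_nat 1; rewrite muln1.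
  rewrite !traceD -natrX !traceZ ?natr_prime_subfield // trace_frob t1 natrX.
  by ring.
by rewrite -{2}[n%:R]add0r (inj_eq (addIr _)) mulf_eq0 expf_eq0 /= (negbTE two0).
Qed.

Lemma card_Ck_excess (p_odd : odd p) k :
  (card_Ck p k F)%:Z - (p%:Z ^+ n + 1) = p%:Z * excess k n%:R.
Proof.
have -> : p%:Z ^+ n = p%:Z * (p ^ n.-1)%:Z by rewrite -PoszM -expnS prednK // -rmorphXn.
by rewrite /card_Ck card_affine_points // PoszD PoszM /excess; ring.
Qed.

End Trace.

(** * Legendre symbols, gcd conditions and square roots of p *)

Lemma intr_pchar_eq0 (R : nzRingType) p (m : int) : p \in [pchar R] ->
  (m%:~R == 0 :> R) = (p %| m)%Z.
Proof.
move=> pR; rewrite dvdzE /= (dvdn_pcharf pR); case: m => m //=.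
by rewrite NegzE mulrNz oppr_eq0.
Qed.

Lemma legendre_euler p (a : int) : prime p -> odd p ->
  (legendre a p)%:~R = a%:~R ^+ p.-1./2 :> 'F_p.
Proof.
move=> p_prime p_odd; rewrite /legendre -(intr_pchar_eq0 _ (pchar_Fp p_prime)).
(* Written as a power so that the results on fields with p^n elements apply with n = 1. *)
have cardFp : #|'F_p| = (p ^ 1)%N by rewrite card_Fp.
have p1 : (1 < p.-1)%N by have := prime_gt1 p_prime; move: p_odd; case: (p) => [|[|[|]]].
case: eqP => [->|/eqP a0]; first by rewrite expr0n gtn_eqF // half_gt0.
have := square_char cardFp p_odd a0.
have dvd := dvdn2_pred_card cardFp p_odd.
have := is_powerP dvd a0; rewrite cardFp expn1 divn2 => sq ->.
have -> : [exists x : 'F_p, x ^+ 2 == a%:~R] = (a%:~R ^+ p.-1./2 == 1 :> 'F_p).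
  by apply/existsP/sq => -[x xa]; exists x; apply/eqP.
by case: ifP.
Qed.

(** Here c stands for l / k, which is 1 or p. With n = g n' and l = g t one has d = g gcd(n', 4t),
    and t is odd whenever n' is even. So the hypotheses on d tell apart n' odd, n' twice an odd
    number, and n' divisible by 4. *)
Lemma gcdn_parity k n c : (0 < k)%N -> odd c ->
  let d := gcdn n (4 * (k * c)) in let g := gcdn k n in
  [/\ (d %| k * c)%N -> odd (n %/ g),
      ~~ (d %| k * c)%N -> (d %/ 2 %| k * c)%N -> exists2 m, odd m & n = (2 * g * m)%N
    & ~~ (d %| 2 * (k * c))%N -> exists2 m, ~~ odd m & n = (2 * g * m)%N].
Proof.
move=> k0 c_odd d g; have g0 : (0 < g)%N by rewrite gcdn_gt0 k0.
have [k' kE] : exists k', k = (g * k')%N.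
  by have /dvdnP[k' ->] := dvdn_gcdl k n; exists k'; rewrite mulnC.
have [n' nE] : exists n', n = (g * n')%N.
  by have /dvdnP[n' {1}->] := dvdn_gcdr k n; exists n'; rewrite mulnC.
have cop : coprime k' n'.
  by rewrite /coprime -(eqn_pmul2l g0) muln_gcdr -kE -nE muln1.
have -> : (n %/ g = n')%N by rewrite nE mulKn.
pose t := (k' * c)%N; have lE : (k * c = g * t)%N by rewrite kE -mulnA.
have t_odd : ~~ odd n' -> odd t.
  move=> n'_even; rewrite oddM c_odd andbT; apply: contraNT n'_even => k'_even.
  have := dvdn_gcd 2 k' n'; rewrite (eqP cop) !dvdn2 k'_even /= => /esym /negbFE.
  by [].
have dE : d = (g * gcdn n' (4 * t))%N by rewrite /d lE nE mulnCA -muln_gcdr.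
have d_odd : odd n' -> (d %| k * c)%N.
  move=> n'_odd; rewrite dE lE dvdn_pmul2l // Gauss_gcdr ?dvdn_gcdr //.
  by rewrite (@coprimeXr 2 n' 2) // coprimen2.
split.
- rewrite dE lE dvdn_pmul2l // => h; apply: contraT => n'_even.
  have : (2 %| gcdn n' (4 * t))%N by rewrite dvdn_gcd dvdn2 n'_even dvdn_mulr.
  by move/dvdn_trans/(_ h); rewrite dvdn2 t_odd.
- move=> nd hd; have n'_even : ~~ odd n' by apply: contra nd.
  exists n'./2; last by rewrite -mulnA mulnCA mul2n even_halfK // -nE.
  (* If 4 divides n', then d / 2 is an even multiple of g, and d / 2 dividing l = g t would make t
     even. *)
  apply: contraT => m_even; have : (4 %| gcdn n' (4 * t))%N.
    rewrite dvdn_gcd dvdn_mulr // andbT -(even_halfK n'_even) -muln2.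
    by rewrite -[4%N]/(2 * 2)%N dvdn_pmul2r // dvdn2.
  case/dvdnP=> s sE; move: hd; rewrite dE sE lE.
  have -> : (g * (s * 4) %/ 2 = g * (s * 2))%N.
    by rewrite -[4%N]/(2 * 2)%N !mulnA mulnK.
  rewrite dvdn_pmul2l // => /(dvdn_trans (dvdn_mull s (dvdnn 2))).
  by rewrite dvdn2 t_odd.
move=> nd; have n'_even : ~~ odd n'.
  by apply: contra nd => /d_odd h; rewrite dvdn_mull.
exists n'./2; last by rewrite -mulnA mulnCA mul2n even_halfK // -nE.
apply: contra nd => m_odd; rewrite dE lE -(even_halfK n'_even) -mul2n.
rewrite mulnCA dvdn_pmul2l // -[4%N]/(2 * 2)%N -mulnA -muln_gcdr dvdn_pmul2l //.
by rewrite Gauss_gcdr ?dvdn_gcdr // coprimen2.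
Qed.

Lemma sqrt_exp_cancel (R : rcfType) p n i j : (0 < p)%N -> (n + i = 2 * j)%N ->
  Num.sqrt p%:R ^- n * p%:R ^+ j = Num.sqrt p%:R ^+ i :> R.
Proof.
move=> p0 eq; have s0 : Num.sqrt p%:R != 0 :> R by rewrite gt_eqF // sqrtr_gt0 ltr0n.
rewrite -[X in X ^+ j](@sqr_sqrtr R p%:R) ?ler0n // -exprM -eq exprD mulKf //.
by rewrite expf_neq0.
Qed.

Lemma legendre_pm1 (a : int) (p : nat) : ~~ (p %| a)%Z ->
  legendre a p = if legendre a p == 1 then 1 else -1.
Proof. by move=> /negbTE pa; rewrite /legendre pa; case: ifP. Qed.

(** The sign (-1)^(hj) of [pstar p ^+ j] is, by Euler's criterion, the Legendre symbol of (-1)^j,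
    and it merges with that of n. *)
Lemma sign_pstar (F : finFieldType) p n : prime p -> odd p -> p \in [pchar F] ->
  ~~ (p %| n)%N ->
  (if n%:R ^+ p.-1./2 == 1 :> F then 1 else -1) * pstar p ^+ n./2
  = legendre ((-1) ^+ n./2 * n%:Z) p * p%:Z ^+ n./2.
Proof.
move=> p_prime p_odd pF pn; set j := n./2; set h := p.-1./2.
set b := _ * n%:Z.
have pb : ~~ (p %| b)%Z.
  by rewrite /b dvdzE abszM abszX exp1n mul1n.
rewrite /pstar exprMn mulrA; congr (_ * _); rewrite -exprM.
(* Equality of integers in F and in ['F_p] is the same divisibility by p, which lets
   [legendre_euler] be used in F. *)
have sg : (n%:R ^+ h : F) = (legendre b p * (-1) ^+ (h * j))%:~R.
  apply/eqP; rewrite -subr_eq0 -[n%:R]/(n%:Z%:~R) -rmorphXn -rmorphB (intr_pchar_eq0 _ pF).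
  rewrite -(intr_pchar_eq0 _ (pchar_Fp p_prime)) rmorphB rmorphM /= legendre_euler //.
  rewrite /b -/h rmorphM /= !rmorphXn /= rmorphN1 exprMn mulrAC -exprM -exprD.
  by rewrite [(j * h)%N]mulnC addnn -signr_odd odd_double mul1r subrr.
have N1 : (-1 == 1 :> F) = false.
  rewrite eq_sym -subr_eq0 opprK -mulr2n -(dvdn_pcharf pF).
  apply: contraTF p_odd => /dvdn_leq -/(_ isT).
  by have := prime_gt1 p_prime; case: (p) => [|[|[|m]]].
rewrite sg (legendre_pm1 pb) -signr_odd.
by case: (_ == 1 :> int); case: odd;
  rewrite ?expr0 ?expr1 ?mulr1 ?mulrN1 ?mulNr ?opprK ?mul1r
  ?rmorphN1 ?rmorph1 ?eqxx ?N1 ?mulrNN ?mulr1.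
Qed.

(* R is any real closed field, in particular the real numbers; F is any field
   with p^n elements; p^(-n/2) is written as (sqrt p)^(-n).  Since d always
   divides 4l, d is even as soon as d does not divide l, so d %/ 2 is exact;
   so are the exponents (n - 1) %/ 2 for n odd and n * (p - 1) %/ 4 for n
   even. *)
Theorem theorem20 (R : rcfType) (p k n : nat) (F : finFieldType)
  (p_prime : prime p) (p_odd : odd p) (k_gt0 : (0 < k)%N) (n_ge1 : (1 <= n)%N)
  (cardF : #|F| = (p ^ n)%N) :
  let l := if (p %| k)%N then k else (k * p)%N in
  let d := gcdn n (4 * l) in
  let v : R := - (Num.sqrt p%:R ^- n
                  * ((card_Ck p k F)%:R - (p%:R ^+ n + 1))) in
  ((d %| l)%N -> odd n -> ~~ (p %| n)%N ->
     v = - ((legendre ((- 1) ^+ ((n - 1) %/ 2)%N * n%:Z) p)%:~R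
            * Num.sqrt p%:R)) /\
  ((d %| l)%N -> odd n -> (p %| n)%N ->
     v = 0) /\
  ((d %| l)%N -> ~~ odd n -> ~~ (p %| n)%N ->
     v = - ((- 1) ^+ (n * (p - 1) %/ 4)%N)) /\
  ((d %| l)%N -> ~~ odd n -> (p %| n)%N ->
     v = (- 1) ^+ (n * (p - 1) %/ 4)%N * (p%:R - 1)) /\
  (~~ (d %| l)%N -> (d %/ 2 %| l)%N -> ~~ (p %| n)%N ->
     v = - 1) /\
  (~~ (d %| l)%N -> (d %/ 2 %| l)%N -> (p %| n)%N ->
     v = p%:R - 1) /\
  (~~ (d %| 2 * l)%N -> (d %| 4 * l)%N -> ~~ (p %| n)%N ->
     v = - (p%:R ^+ gcdn k n)) /\
  (~~ (d %| 2 * l)%N -> (d %| 4 * l)%N -> (p %| n)%N ->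
     v = (p%:R - 1) * p%:R ^+ gcdn k n).
Proof.
move=> l d v.
have [c c_odd lE] : exists2 c, odd c & l = (k * c)%N.
  by rewrite /l; case: ifP => _; [exists 1%N; rewrite ?muln1 | exists p].
have [P1 P2 P3] := gcdn_parity n k_gt0 c_odd; rewrite -lE -/d in P1 P2 P3.
pose s : R := Num.sqrt p%:R; pose X := p%:Z * excess p n k (n%:R : F).
have p_gt0 := prime_gt0 p_prime.
have vE : v = - (s ^- n * X%:~R).
  rewrite /v -/s /X -(card_Ck_excess p_prime n_ge1 cardF p_odd k).
  by rewrite rmorphB /= intrD rmorphXn.
have nF : (n%:R == 0 :> F) = (p %| n)%N by rewrite (dvdn_pcharf (pcharF p_prime cardF)).
have nP : (n%:R : F) \in prime_subfield F p := natr_prime_subfield p_prime cardF n.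
have reduce : excess p n k (n%:R : F)
    = excess p n (if odd (n %/ gcdn k n) then 0 else gcdn k n) (n%:R : F).
  by rewrite /excess (level_reduce p_prime n_ge1 cardF p_odd).
have gE g m : (0 < g)%N -> n = (2 * g * m)%N -> X = p%:Z * excess p n g (n%:R : F) ->
    X = (if (p %| n)%N then - p.-1%:Z else 1) * p%:Z ^+ (g * (m + ~~ odd m)).
  move=> g0 nE ->; have [cst E0 <-] := excess_even p_prime n_ge1 cardF p_odd g0 nE.
  case: ifPn => pn; last by rewrite mul1r cst ?nF.
  by move: pn; rewrite -nF => /eqP ->; rewrite E0; ring.
have pR : p.-1%:R = p%:R - 1 :> R by rewrite -subn1 natrB.
have gk0 : (0 < gcdn k n)%N by rewrite gcdn_gt0 k_gt0.
have X_odd : (d %| l)%N -> X = p%:Z * excess p n 0 (n%:R : F).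
  by move=> /P1 h; rewrite /X reduce h.
have X_even m : n = (2 * gcdn k n * m)%N ->
    X = (if (p %| n)%N then - p.-1%:Z else 1) * p%:Z ^+ (gcdn k n * (m + ~~ odd m)).
  move=> nE; apply: gE => //; rewrite /X reduce.
  have -> : (n %/ gcdn k n = 2 * m)%N by rewrite {1}nE mulnAC mulnK.
  by rewrite mul2n odd_double.
have n_half : ~~ odd n -> (n + 0 = 2 * n./2)%N.
  by move=> n_even; rewrite addn0 mul2n even_halfK.
have pstarE : (pstar p ^+ n./2)%:~R = (-1) ^+ (p.-1./2 * n./2) * p%:R ^+ n./2 :> R.
  by rewrite rmorphXn rmorphM /= exprMn rmorphXn /= rmorphN1 -exprM.
have expE : ~~ odd n -> (n * (p - 1) %/ 4 = p.-1./2 * n./2)%N.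
  move=> n_even; rewrite -{1}(even_halfK n_even) subn1 {1}half_pred //.
  by rewrite -!muln2 mulnACA mulnK // mulnC.
have v_sq_even : (d %| l)%N -> ~~ odd n ->
    v = - ((if (p %| n)%N then - (p%:R - 1) else 1) * (-1) ^+ (n * (p - 1) %/ 4)).
  move=> dl n_even; rewrite vE X_odd // expE //; congr (- _).
  have [cst E0 pE] := excess_square_even p_prime n_ge1 cardF p_odd n_even.
  have -> : p%:Z * excess p n 0 (n%:R : F)
      = (if (p %| n)%N then - p.-1%:Z else 1) * pstar p ^+ n./2.
    rewrite -pE; case: ifPn => pn; last by rewrite mul1r cst ?nF.
    by move: pn; rewrite -nF => /eqP ->; rewrite E0; ring.
  rewrite rmorphM /= pstarE -pR mulrCA; congr (_ * _).
    by case: ifP; rewrite ?rmorphN.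
  by rewrite mulrCA (sqrt_exp_cancel _ p_gt0 (n_half n_even)) expr0 mulr1.
(* i is the excess of the exponent of sqrt p over n: 0 for m odd, 2 gcd(k,n) for m even. *)
have v_even m i : n = (2 * gcdn k n * m)%N ->
    (n + i = 2 * (gcdn k n * (m + ~~ odd m)))%N ->
    v = - ((if (p %| n)%N then - (p%:R - 1) else 1) * s ^+ i).
  move=> nE ni; rewrite vE (X_even m nE) rmorphM /= rmorphXn /= mulrCA.
  rewrite (sqrt_exp_cancel _ p_gt0 ni) -pR; congr (- (_ * _)).
  by case: ifP; rewrite ?rmorphN.
have v1 : ~~ (d %| l)%N -> (d %/ 2 %| l)%N ->
    v = - (if (p %| n)%N then - (p%:R - 1) else 1).
  move=> h1 h2; have [m m_odd nE] := P2 h1 h2.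
  rewrite (v_even m 0%N) ?expr0 ?mulr1 // m_odd /= !addn0 mulnA.
  exact: nE.
have v2 : ~~ (d %| 2 * l)%N ->
    v = - ((if (p %| n)%N then - (p%:R - 1) else 1) * p%:R ^+ gcdn k n).
  move=> /P3[m m_even nE].
  rewrite (v_even m (2 * gcdn k n)%N) // ?exprM ?sqr_sqrtr ?ler0n //.
  by rewrite m_even addn1 mulnA mulnS addnC -nE.
do !split.
- move=> dl n_odd pn; rewrite vE X_odd //.
  rewrite (excess_square_odd p_prime n_ge1 cardF p_odd n_odd) ?nF //.
  rewrite (sign_pstar p_prime p_odd (pcharF p_prime cardF) pn).
  have -> : ((n - 1) %/ 2 = n./2)%N.
    by rewrite subn1 divn2 -[in LHS](odd_double_half n) n_odd add1n /= doubleK.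
  rewrite mulrCA -exprS rmorphM /= rmorphXn /= mulrCA.
  (* For n odd, p^((n+1)/2) exceeds p^(n/2) by one factor sqrt p. *)
  rewrite (@sqrt_exp_cancel _ _ _ 1) ?expr1 //.
  by rewrite mul2n doubleS -[in LHS](odd_double_half n) n_odd add1n addn1.
- move=> dl n_odd; rewrite -nF => /eqP n0; rewrite vE X_odd // n0.
  by rewrite (excess_square_odd0 p_prime n_ge1 cardF p_odd n_odd) mulr0 mulr0 oppr0.
- by move=> dl n_even /negbTE pn; rewrite v_sq_even // pn mul1r.
- by move=> dl n_even pn; rewrite v_sq_even // pn mulNr opprK mulrC.
- by move=> h1 h2 /negbTE pn; rewrite v1 // pn.
- by move=> h1 h2 pn; rewrite v1 // pn opprK.
- by move=> h1 _ /negbTE pn; rewrite v2 // pn mul1r.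
- by move=> h1 _ pn; rewrite v2 // pn mulNr opprK.
Qed.
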